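(* Fix integers $j\ge i\ge 1$. The \textsc{$k$-Independent Dominating Set} problem, parameterized by $k$ and restricted to input graphs that contain no subgraph isomorphic to $K_{i,j}$, has a polynomial kernel with $O(j k^{i})$ vertices.
   Context: All graphs are finite, simple and undirected. A dominating set of a graph $G=(V,E)$ is a set $S\subseteq V$ such that every vertex of $V\setminus S$ is adjacent to some vertex of $S$; it is independent if no two vertices of $S$ are adjacent. The \textsc{$k$-Independent Dominating Set} problem: given a graph $G$ and a positive integer $k$, decide whether $G$ has an independent dominating set of size at most $k$; the parameter is $k$. $K_{i,j}$ denotes the complete bipartite graph with parts of sizes $i$ and $j$; a graph is $K_{i,j}$-free if it has no (not necessarily induced) subgraph isomorphic to $K_{i,j}$. A kernel is a polynomial-time algorithm that, given $(G,k)$, outputs an equivalent instance $(G',k')$ (i.e. the answer for $(G,k)$ is yes iff the answer for $(G',k')$ is yes) whose size is bounded by a function of $k$ alone and with $k'$ bounded by a function of $k$; here the number of vertices of $G'$ is bounded as stated. *)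

(* Defs.v *)
From mathcomp Require Import all_boot.
Set Implicit Arguments.
Unset Strict Implicit.
Unset Printing Implicit Defensive.

(** * Graphs and independent domination *)

(* Vertex sets are of the form 'I_n, so that graphs can be given to machines. *)
Record sgraph := SGraph {
  nv : nat;
  adj : rel 'I_nv;
  adj_sym : symmetric adj;
  adj_irr : irreflexive adj
}.

Definition dominating (G : sgraph) (S : {set 'I_(nv G)}) : Prop :=
  forall v, v \notin S -> exists2 u, u \in S & adj v u.

Definition independent (G : sgraph) (S : {set 'I_(nv G)}) : Prop :=
  {in S &, forall u v, ~~ adj u v}.

Definition bip_rel (i j : nat) : rel 'I_(i + j) :=
  fun u v => (u < i) (+) (v < i).

Lemma bip_sym i j : symmetric (@bip_rel i j).
Proof. by move=> u v; rewrite /bip_rel addbC. Qed.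

Lemma bip_irr i j : irreflexive (@bip_rel i j).
Proof. by move=> u; rewrite /bip_rel addbb. Qed.

Definition complete_bipartite (i j : nat) : sgraph :=
  SGraph (@bip_sym i j) (@bip_irr i j).

(* [G] has a (not necessarily induced) subgraph isomorphic to [H]. *)
Definition has_subgraph (H G : sgraph) : Prop :=
  exists2 f : 'I_(nv H) -> 'I_(nv G),
    injective f & forall u v, adj u v -> adj (f u) (f v).

Record instance := Instance { igraph : sgraph; iparam : nat }.

Definition ids_yes (x : instance) : Prop :=
  exists S : {set 'I_(nv (igraph x))},
    [/\ dominating S, independent S & #|S| <= iparam x].

Definition bip_free_instance (i j : nat) (x : instance) : Prop :=
  0 < iparam x /\ ~ has_subgraph (complete_bipartite i j) (igraph x).

(* Number of vertices, parameter, then the adjacency matrix in row-major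
   order. *)
Definition encode (x : instance) : seq nat :=
  nv (igraph x) :: iparam x ::
  [seq (adj u v : nat) | u <- enum 'I_(nv (igraph x)),
                         v <- enum 'I_(nv (igraph x))].

(* Total number of binary digits of the encoding; in particular the parameter
   counts for its binary length only. *)
Definition isize (x : instance) : nat :=
  \sum_(a <- encode x) (trunc_log 2 a).+1.

(** * Random access machines

    Structured programs for a random access machine with a write-only output
    tape.  Every operation has unit cost.  The only arithmetic operations are
    addition and truncated subtraction, so that the binary length of the numbers
    grows by at most one at each step; unit-cost time is then polynomially
    related to Turing machine time (this would fail with unit-cost
    multiplication). *)

Inductive expr :=
  | Cst of nat
  | Read of expr  (* content of the cell whose address is the argument *)
  | Plus of expr & expr
  | Minus of expr & expr.

Inductive prog :=
  | Skip
  | Store of expr & expr  (* address, value *)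
  | Emit of expr
  | Seq of prog & prog
  | If of expr & prog & prog  (* a test succeeds when its value is nonzero *)
  | While of expr & prog.

Definition memory := nat -> nat.

Fixpoint eval (m : memory) (e : expr) : nat :=
  match e with
  | Cst n => n
  | Read a => m (eval m a)
  | Plus a b => eval m a + eval m b
  | Minus a b => eval m a - eval m b
  end.

Fixpoint ecost (e : expr) : nat :=
  match e with
  | Cst _ => 1
  | Read a => (ecost a).+1
  | Plus a b | Minus a b => (ecost a + ecost b).+1
  end.

Definition update (m : memory) (a v : nat) : memory :=
  fun b => if b == a then v else m b.

(* [exec p m o t m' o']: started with memory [m] and output [o], the program [p]
   halts after time [t] with memory [m'] and output [o']. *)
Inductive exec :
    prog -> memory -> seq nat -> nat -> memory -> seq nat -> Prop :=
  | exec_skip m o : exec Skip m o 1 m o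
  | exec_store a e m o :
      exec (Store a e) m o (ecost a + ecost e).+1
        (update m (eval m a) (eval m e)) o
  | exec_emit e m o :
      exec (Emit e) m o (ecost e).+1 m (rcons o (eval m e))
  | exec_seq p q m o t m1 o1 t' m2 o2 :
      exec p m o t m1 o1 -> exec q m1 o1 t' m2 o2 ->
      exec (Seq p q) m o (t + t') m2 o2
  | exec_if_true e p q m o t m1 o1 :
      eval m e != 0 -> exec p m o t m1 o1 ->
      exec (If e p q) m o (ecost e + t).+1 m1 o1
  | exec_if_false e p q m o t m1 o1 :
      eval m e = 0 -> exec q m o t m1 o1 ->
      exec (If e p q) m o (ecost e + t).+1 m1 o1
  | exec_while_true e p m o t m1 o1 t' m2 o2 :
      eval m e != 0 -> exec p m o t m1 o1 ->
      exec (While e p) m1 o1 t' m2 o2 ->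
      exec (While e p) m o (ecost e + t + t').+1 m2 o2
  | exec_while_false e p m o :
      eval m e = 0 -> exec (While e p) m o (ecost e).+1 m o.

Lemma exec_det p m o t m1 o1 t' m2 o2 :
  exec p m o t m1 o1 -> exec p m o t' m2 o2 ->
  [/\ t = t', m1 = m2 & o1 = o2].
Proof.
move=> E; elim: E t' m2 o2 => {p m o t m1 o1}.
all: intros.
all: match goal with
     | H : exec _ _ _ ?t ?m ?o |- [/\ _ = ?t, _ = ?m & _ = ?o] =>
       inversion H; subst; clear H
     end.
all: repeat match goal with
     | IH : forall t m o, exec ?p ?m0 ?o0 t m o -> _,
       H : exec ?p ?m0 ?o0 _ _ _ |- _ => case: (IH _ _ _ H) => ? ? ?; subst; clear H
     | H : is_true (?a != 0), H' : ?a = 0 |- _ => by rewrite H' in H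
     end.
all: by [].
Qed.

(* The input is stored in the first memory cells, the others contain 0. *)
Definition computes (p : prog) (x : instance) (t : nat) (y : instance) : Prop :=
  exists m, exec p (nth 0 (encode x)) [::] t m (encode y).

(** * Kernels *)

Definition poly_bounded (f : nat -> nat) : Prop :=
  exists d, forall n, f n <= d * n ^ d + d.

(* The problem [yes], restricted to the instances in [cls], has a polynomial
   kernel with at most [h k] vertices.  The functions [time], [size] and [par]
   bound the running time (in the input size), the size of the output and the
   parameter of the output (in the parameter of the input). *)
Definition has_poly_kernel (cls yes : instance -> Prop) (h : nat -> nat) : Prop :=
  exists (A : prog) (time size par : nat -> nat),
    [/\ poly_bounded time, poly_bounded size &
     forall x, cls x -> exists (y : instance) (t : nat),
       [/\ computes A x t y /\ t <= time (isize x),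
           cls y,
           yes x <-> yes y,
           isize y <= size (iparam x) /\ iparam y <= par (iparam x) &
           nv (igraph y) <= h (iparam x)]].

(* Main.v *)
(** Let [k' = minn k n], [t_i = j - 1] and [t_r = k' * (t_(r+1) + 1) + 1].  For
    [r = i - 1, ..., 0] and for every set [U] of [r] vertices, delete all but [t_r]
    common neighbours of [U].  When every set of [r + 1] vertices has at most
    [t_(r+1)] common neighbours, a vertex outside [U] dominates at most
    [t_(r+1) + 1] common neighbours of [U]; so if [U] has at least [t_r] of them,
    every solution [S] meets [U].  By independence [S] then contains no common
    neighbour of [U], and it dominates all of them from [U], so that deleting a
    common neighbour in excess of [t_r] changes nothing.  At [r = 0] this leaves at
    most [t_0 <= 3 j k^i] vertices (if there are that many, there is no solution),
    and [k] is unchanged.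

    The algorithm is written in a language whose only loops repeat a command [n]
    times, so that a program has a total denotation and its compilation to a
    random access machine takes polynomial time. *)

Require Import Defs.
From Stdlib Require Import FunctionalExtensionality.
From mathcomp Require Import all_boot zify.
Set Implicit Arguments.
Unset Strict Implicit.
Unset Printing Implicit Defensive.

(** * Loop programs and their compilation *)

(* [VMat] reads the input adjacency matrix in row-major order, [VGet] the working
   memory. *)
Inductive vexpr :=
  | VCst of nat
  | VOrder
  | VMat of vexpr
  | VGet of vexpr
  | VAdd of vexpr & vexpr
  | VSub of vexpr & vexpr.

Inductive cmd :=
  | CSkip
  | CSet of vexpr & vexpr
  | CEmit of vexpr
  | CSeq of cmd & cmd
  | CIf of vexpr & cmd & cmd
  | CRep of cmd.

Section LoopPrograms.

Variables (n : nat) (M : nat -> nat).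

Fixpoint veval (V : memory) (e : vexpr) : nat :=
  match e with
  | VCst c => c
  | VOrder => n
  | VMat a => M (veval V a)
  | VGet a => V (veval V a)
  | VAdd a b => veval V a + veval V b
  | VSub a b => veval V a - veval V b
  end.

Fixpoint den (c : cmd) (s : memory * seq nat) : memory * seq nat :=
  match c with
  | CSkip => s
  | CSet a e => (update s.1 (veval s.1 a) (veval s.1 e), s.2)
  | CEmit e => (s.1, rcons s.2 (veval s.1 e))
  | CSeq p q => den q (den p s)
  | CIf e p q => if veval s.1 e != 0 then den p s else den q s
  | CRep p => iter n (den p) s
  end.

End LoopPrograms.

Fixpoint depth (c : cmd) : nat :=
  match c with
  | CSeq p q | CIf _ p q => maxn (depth p) (depth q)
  | CRep p => (depth p).+1
  | _ => 0
  end.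

Section Compilation.

Variable K : nat.

(** The end of the matrix depends on [n], so the start of the counters is read from cell 1 at run
    time. *)
Definition base_ptr := Read (Cst 1).
Definition counter (d : nat) := Plus base_ptr (Cst d).
Definition vaddr (e : expr) := Plus (counter K) e.
(* Caps an address at the cell just below the working memory, which contains 0; thus
   reading the matrix out of bounds gives 0. *)
Definition guard (e : expr) := Minus e (Minus e (Minus base_ptr (Cst 1))).

Fixpoint vcompile (e : vexpr) : expr :=
  match e with
  | VCst c => Cst c
  | VOrder => Read (Cst 0)
  | VMat a => Read (guard (Plus (Cst 2) (vcompile a)))
  | VGet a => Read (vaddr (vcompile a))
  | VAdd a b => Plus (vcompile a) (vcompile b)
  | VSub a b => Minus (vcompile a) (vcompile b)
  end.

Fixpoint compile (d : nat) (c : cmd) : prog :=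
  match c with
  | CSkip => Skip
  | CSet a e => Store (vaddr (vcompile a)) (vcompile e)
  | CEmit e => Emit (vcompile e)
  | CSeq p q => Seq (compile d p) (compile d q)
  | CIf e p q => If (vcompile e) (compile d p) (compile d q)
  | CRep p =>
      Seq (Store (counter d) (Read (Cst 0)))
        (While (Read (counter d))
           (Seq (compile d.+1 p)
              (Store (counter d) (Minus (Read (counter d)) (Cst 1)))))
  end.

(** An upper bound, since a conditional is charged for both branches. An iteration of a loop spends
    6 on the test and 12 on the decrement, hence 18; the 13 is 7 for initializing the counter and 6
    for the final failing test. *)
Fixpoint tcost (c : cmd) (n : nat) : nat :=
  match c with
  | CSkip => 1
  | CSet a e => (ecost (vaddr (vcompile a)) + ecost (vcompile e)).+1
  | CEmit e => (ecost (vcompile e)).+1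
  | CSeq p q => tcost p n + tcost q n
  | CIf e p q => (ecost (vcompile e) + (tcost p n + tcost q n)).+1
  | CRep p => n * (tcost p n + 18) + 13
  end.

Variables (n : nat) (M : nat -> nat).
Hypothesis M_out : forall a, n * n <= a -> M a = 0.

Let B := n * n + 3.

(* Order, base pointer, matrix, one cell containing 0, [K] hidden loop counters [cs],
   then the working memory [V]. *)
Definition vmem (cs V : memory) : memory := fun a =>
  if a < B then (if a == 0 then n else if a == 1 then B else M (a - 2))
  else if a < B + K then cs (a - B) else V (a - (B + K)).

Lemma vmem_set cs V a x :
  update (vmem cs V) (B + K + a) x = vmem cs (update V a x).
Proof.
apply: functional_extensionality => b; rewrite /update /vmem.
case: (ltnP b B) => hb; first by rewrite ifF //; lia.
case: (ltnP b (B + K)) => hb2; first by rewrite ifF //; lia.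
by have -> : (b == B + K + a) = (b - (B + K) == a) by lia.
Qed.

Lemma vmem_counter cs V d x : d < K ->
  update (vmem cs V) (B + d) x = vmem (update cs d x) V.
Proof.
move=> hd; apply: functional_extensionality => b; rewrite /update /vmem.
case: (ltnP b B) => hb; first by rewrite ifF //; lia.
case: (ltnP b (B + K)) => hb2; last by rewrite ifF //; lia.
by have -> : (b == B + d) = (b - B == d) by lia.
Qed.

Lemma vmem0 cs V : vmem cs V 0 = n.
Proof. by rewrite /vmem ifT // /B; lia. Qed.

Lemma vmem1 cs V : vmem cs V 1 = B.
Proof. by rewrite /vmem ifT // /B; lia. Qed.

Lemma vmem_get_counter cs V d : d < K -> vmem cs V (B + d) = cs d.
Proof. by move=> hd; rewrite /vmem ifF ?ifT ?addKn //; lia. Qed.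

Lemma vmem_get cs V a : vmem cs V (B + K + a) = V a.
Proof. by rewrite /vmem !ifF ?addKn //; lia. Qed.

Lemma vmem_mat cs V a :
  vmem cs V (2 + a - (2 + a - (B - 1))) = M a.
Proof.
have [ha|ha] := ltnP a (n * n).
  have -> : 2 + a - (2 + a - (B - 1)) = a.+2 by rewrite /B; lia.
  by rewrite /vmem ifT ?ifF ?subn2 //= /B; lia.
have -> : 2 + a - (2 + a - (B - 1)) = (n * n).+2 by rewrite /B; lia.
by rewrite /vmem ifT ?ifF ?subn2 //= ?[RHS]M_out ?M_out // /B; lia.
Qed.

Lemma vcompileP cs V e : eval (vmem cs V) (vcompile e) = veval n M V e.
Proof.
elim: e => //= [|a IHa|a IHa|a -> b ->|a -> b ->] //; rewrite ?vmem0 //.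
  by rewrite IHa vmem1 vmem_mat.
by rewrite IHa vmem1 vmem_get.
Qed.

Lemma update_update (f : memory) a x y : update (update f a x) a y = update f a y.
Proof.
by apply: functional_extensionality => b; rewrite /update; case: eqP.
Qed.

Lemma update_id (f : memory) a : update f a (f a) = f.
Proof.
by apply: functional_extensionality => b; rewrite /update; case: eqP => // ->.
Qed.

(** A finished loop leaves 0 in its counter. If the counters from depth [d] on are 0 at the start,
    running a command at depth [d] therefore restores all of [cs]. *)
Definition zero_from d (cs : memory) := forall a, d <= a < K -> cs a = 0.

Lemma while_compile d c cs V o a :
    d < K -> zero_from d.+1 cs -> cs d = a ->
    (forall cs V o, zero_from d.+1 cs -> exists2 t, t <= tcost c n &
      exec (compile d.+1 c) (vmem cs V) o t
        (vmem cs (den n M c (V, o)).1) (den n M c (V, o)).2) ->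
  exists2 t, t <= a * (tcost c n + 18) + 6 &
    exec (While (Read (counter d))
           (Seq (compile d.+1 c)
              (Store (counter d) (Minus (Read (counter d)) (Cst 1)))))
      (vmem cs V) o t
      (vmem (update cs d 0) (iter a (den n M c) (V, o)).1)
      (iter a (den n M c) (V, o)).2.
Proof.
move=> hd hcs ha hc; elim: a cs hcs V o ha => [|a IHa] cs hcs V o ha.
  have -> : update cs d 0 = cs by rewrite -ha update_id.
  exists 6 => //.
  by apply: exec_while_false; rewrite /= vmem1 vmem_get_counter.
have [t1 ht1 e1] := hc cs V o hcs.
move: e1; set V1 := (den _ _ _ _).1; set o1 := (den _ _ _ _).2 => e1.
have [||t2 ht2 e2] := IHa (update cs d a) _ V1 o1.
- by move=> b hb; rewrite /update ifF ?hcs //; lia.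
- by rewrite /update eqxx.
exists (5 + (t1 + 12) + t2).+1; first by lia.
rewrite update_update /V1 /o1 -surjective_pairing -iterSr in e2.
apply: exec_while_true e2; first by rewrite /= vmem1 vmem_get_counter // ha.
apply: (exec_seq e1).
have := exec_store (counter d) (Minus (Read (counter d)) (Cst 1)) (vmem cs V1) o1.
rewrite /= vmem1 vmem_get_counter // vmem_counter // ha subn1; exact.
Qed.

Lemma compileP c d cs V o : d + depth c <= K -> zero_from d cs ->
  exists2 t, t <= tcost c n &
    exec (compile d c) (vmem cs V) o t
      (vmem cs (den n M c (V, o)).1) (den n M c (V, o)).2.
Proof.
elim: c d cs V o => [|a e|e|p IHp q IHq|e p IHp q IHq|p IHp] d cs V o hd hcs.
- by exists 1 => //; exact: exec_skip.
- exists (ecost (vaddr (vcompile a)) + ecost (vcompile e)).+1 => //.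
  have := exec_store (vaddr (vcompile a)) (vcompile e) (vmem cs V) o.
  rewrite /= !vcompileP vmem1 vmem_set; exact.
- exists (ecost (vcompile e)).+1 => //.
  have := exec_emit (vcompile e) (vmem cs V) o.
  rewrite /= vcompileP; exact.
- have [||t1 h1 e1] := IHp d cs V o; [by move: hd => /=; lia|by []|].
  have [||t2 h2 e2] := IHq d cs (den n M p (V, o)).1 (den n M p (V, o)).2;
    [by move: hd => /=; lia|by []|].
  exists (t1 + t2); first exact: leq_add.
  by apply: (exec_seq e1); rewrite -surjective_pairing in e2.
- rewrite /=; case: ifPn => he.
    have [||t1 h1 e1] := IHp d cs V o; [by move: hd => /=; lia|by []|].
    exists (ecost (vcompile e) + t1).+1; first by lia.
    by apply: exec_if_true => //; rewrite vcompileP.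
  have [||t1 h1 e1] := IHq d cs V o; [by move: hd => /=; lia|by []|].
  exists (ecost (vcompile e) + t1).+1; first by lia.
  by apply: exec_if_false => //; rewrite vcompileP; apply/eqP/negPn.
- have hdK : d < K by move: hd => /=; lia.
  have [||||t ht et] := @while_compile d p (update cs d n) V o n.
  + by [].
  + by move=> b hb; rewrite /update ifF ?hcs //; lia.
  + by rewrite /update eqxx.
  + by move=> *; apply: IHp => //; move: hd => /=; lia.
  + exists (7 + t); first by rewrite /=; lia.
    (* The loop ends with counter [d] at 0, which was its value before the loop. *)
    have cs0 : update cs d 0 = cs by rewrite -[RHS](update_id cs d) hcs //; lia.
    rewrite update_update cs0 in et.
    apply: exec_seq et.
    have := exec_store (counter d) (Read (Cst 0)) (vmem cs V) o.
    rewrite /= vmem0 vmem1 vmem_counter //; exact.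
Qed.

End Compilation.

(** * Closure properties of polynomially bounded functions *)

Lemma poly_bounded_mono f g :
  (forall n, f n <= g n) -> poly_bounded g -> poly_bounded f.
Proof. by move=> fg [d hd]; exists d => n; exact: leq_trans (fg n) (hd n). Qed.

Lemma poly_bounded_cst c : poly_bounded (fun=> c).
Proof. by exists c => n; rewrite leq_addl. Qed.

Lemma poly_bounded_id : poly_bounded id.
Proof. by exists 1 => n; rewrite mul1n expn1 leq_addr. Qed.

(** Used to raise two bounds to a common constant. The case [n = 0] is separate because powers of 0
    are not monotone in the exponent. *)
Lemma leq_poly d e n : d <= e -> d * n ^ d + d <= e * n ^ e + e.
Proof.
move=> de; case: n => [|n].
  by case: d de => [|d] de //; rewrite exp0n //; case: e de => // e; rewrite exp0n //; lia.
by rewrite leq_add // leq_mul // leq_pexp2l.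
Qed.

Lemma poly_bounded_add f g :
  poly_bounded f -> poly_bounded g -> poly_bounded (fun n => f n + g n).
Proof.
move=> [d hd] [e he]; exists (d + e + (d + e)) => n.
have h1 := leq_trans (hd n) (leq_poly n (leq_addr e d)).
have h2 := leq_trans (he n) (leq_poly n (leq_addl d e)).
apply: leq_trans (leq_add h1 h2) _; case: n {h1 h2} => [|n].
  by case: (d + e) => [|c] //; rewrite !exp0n ?addn_gt0 //; lia.
have : n.+1 ^ (d + e) <= n.+1 ^ (d + e + (d + e)) by rewrite leq_pexp2l // leq_addr.
by nia.
Qed.

Lemma poly_bounded_mul f g :
  poly_bounded f -> poly_bounded g -> poly_bounded (fun n => f n * g n).
Proof.
move=> [d hd] [e he].
(* Put [c = d + e] and [x = n ^ c]. For [x >= 1] the square of [c * x + c] is at most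
   [3 * c^2 * x^2 + c^2]; the added [c + c] makes the exponent at least [2 * c], so that the new
   power dominates [x^2]. *)
exists ((d + e) * (d + e) * 3 + (d + e) + (d + e)) => n.
have h1 := leq_trans (hd n) (leq_poly n (leq_addr e d)).
have h2 := leq_trans (he n) (leq_poly n (leq_addl d e)).
apply: leq_trans (leq_mul h1 h2) _; move: (d + e) => c.
case: n {h1 h2} => [|n].
  by case: c => [|c] //; rewrite !exp0n ?addn_gt0 ?orbT //; lia.
set x := n.+1 ^ c; set y := n.+1 ^ (c * c * 3 + c + c).
have x_gt0 : 0 < x by rewrite expn_gt0.
have xy : x * x <= y by rewrite -expnD leq_pexp2l //; lia.
have : c * c * 3 * (x * x) <= c * c * 3 * y by rewrite leq_mul2l xy orbT.
by move: x_gt0; clearbody x y; clear; case: x => // x _; nia.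
Qed.

Lemma poly_bounded_exp f m : poly_bounded f -> poly_bounded (fun n => f n ^ m).
Proof.
move=> hf; elim: m => [|m IHm]; first exact: poly_bounded_cst.
apply: poly_bounded_mono (poly_bounded_mul hf IHm) => n.
by rewrite expnS.
Qed.

(** For a fixed command all expression costs are constants, and each [CRep] contributes one factor
    [n]. *)
Lemma poly_bounded_tcost K c : poly_bounded (tcost K c).
Proof.
elim: c => [|a e|e|p IHp q IHq|e p IHp q IHq|p IHp] /=;
  try exact: poly_bounded_cst.
- exact: poly_bounded_add.
- apply: (@poly_bounded_mono _
    (fun n => (ecost (vcompile K e)).+1 + (tcost K p n + tcost K q n))) => //.
  by apply: poly_bounded_add (poly_bounded_cst _) (poly_bounded_add _ _).
- apply: poly_bounded_add (poly_bounded_cst _).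
  apply: poly_bounded_mul poly_bounded_id _.
  exact: poly_bounded_add IHp (poly_bounded_cst _).
Qed.

(* Cells [2] and [n + 3] hold diagonal entries of the matrix, or lie beyond it, so they
   contain 0 and can serve as scratch registers for computing [n * n]. *)
Definition order_expr := Read (Cst 0).
Definition square_addr := Plus order_expr (Cst 3).

Definition square_loop : prog :=
  While (Minus order_expr (Read (Cst 2)))
    (Seq (Store square_addr (Plus (Read square_addr) order_expr))
         (Store (Cst 2) (Plus (Read (Cst 2)) (Cst 1)))).

(** The parameter moves from cell 1 to the first cell of the working memory before cell 1 receives
    the base pointer. The scratch cells are then reset to 0, their original value. *)
Definition setup (K : nat) : prog :=
  Seq square_loop
    (Seq (Store (Plus (Read square_addr) (Cst (3 + K))) (Read (Cst 1)))
       (Seq (Store (Cst 1) (Plus (Read square_addr) (Cst 3)))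
          (Seq (Store (Cst 2) (Cst 0)) (Store square_addr (Cst 0))))).

(** * Correctness of the initial rearrangement of the memory *)

Section Setup.

Variables (n : nat) (m0 : memory).
Hypotheses (m0_order : m0 0 = n) (m0_out : forall a, n * n + 2 <= a -> m0 a = 0).
Hypotheses (m0_2 : m0 2 = 0) (m0_n3 : m0 (n + 3) = 0).

Let sq_mem b := update (update m0 2 b) (n + 3) (b * n).

Lemma square_loopP : exists2 t, t <= n * 25 + 6 &
  exec square_loop m0 [::] t (sq_mem n) [::].
Proof.
have sq0 b : sq_mem b 0 = n by rewrite /sq_mem /update ifF ?m0_order //; lia.
have sq2 b : sq_mem b 2 = b by rewrite /sq_mem /update ifF //; lia.
have sqn b : sq_mem b (n + 3) = b * n by rewrite /sq_mem /update eqxx.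
have <- : sq_mem 0 = m0.
  rewrite /sq_mem mul0n -[X in update m0 2 X]m0_2 update_id.
  by rewrite -[X in update m0 _ X]m0_n3 update_id.
suff : forall a b, a + b = n -> exists2 t, t <= a * 25 + 6 &
    exec square_loop (sq_mem b) [::] t (sq_mem n) [::].
  by apply; rewrite addn0.
elim=> [|a IHa] b hab.
  exists 6 => //; rewrite -hab add0n.
  by apply: exec_while_false; rewrite /= sq0 sq2 -hab subnn.
have [|t ht et] := IHa b.+1; first by rewrite -hab addnS.
exists (5 + (13 + 6) + t).+1; first by lia.
apply: exec_while_true et; first by rewrite /= sq0 sq2; lia.
apply: exec_seq; first exact: exec_store.
have -> : sq_mem b.+1 = update (update (sq_mem b) (n + 3) (b * n + n)) 2 b.+1.
  apply: functional_extensionality => c; rewrite /sq_mem /update mulSnr.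
  by case: (c =P 2) => [->|_]; [rewrite ifF //; lia | case: ifP].
rewrite /= sq0 sqn.
have : update (sq_mem b) (n + 3) (b * n + n) 2 = b.
  by rewrite /update ifF ?sq2 //; lia.
move: (update (sq_mem b) (n + 3) _) => m m2.
have := exec_store (Cst 2) (Plus (Read (Cst 2)) (Cst 1)) m [::].
by rewrite /= m2 (addn1 b).
Qed.

(** For [n <= 1] the scratch cell [n + 3] is the base [n * n + 3] itself; [0 < K] makes it a loop
    counter, distinct from the new cell of the parameter. *)
Lemma setupP K : 0 < K -> exists2 t, t <= n * 25 + 34 &
  exec (setup K) m0 [::] t
    (vmem K n (fun a => m0 a.+2) (fun=> 0) (update (fun=> 0) 0 (m0 1))) [::].
Proof.
move=> K_gt0; have [t ht et] := square_loopP.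
exists (t + (10 + (9 + (3 + 6)))); first by lia.
apply: (exec_seq et).
have sq0 : sq_mem n 0 = n by rewrite /sq_mem /update ifF ?m0_order //; lia.
have sqn : sq_mem n (n + 3) = n * n by rewrite /sq_mem /update eqxx.
have sq1 : sq_mem n 1 = m0 1 by rewrite /sq_mem /update ifF //; lia.
set m1 := update (sq_mem n) (n * n + (3 + K)) (m0 1).
set m2 := update m1 1 (n * n + 3).
have m10 : m1 0 = n by rewrite /m1 /update ifF ?sq0 //; lia.
have m1n : m1 (n + 3) = n * n.
  by rewrite /m1 /update ifF ?sqn //; case: n => [|[|p]]; lia.
have m20 : m2 0 = n by [].
apply: (@exec_seq _ _ _ _ 10 m1).
  have := exec_store (Plus (Read square_addr) (Cst (3 + K))) (Read (Cst 1))
    (sq_mem n) [::].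
  rewrite /= sq0 sqn sq1; exact.
apply: (@exec_seq _ _ _ _ 9 m2).
  have := exec_store (Cst 1) (Plus (Read square_addr) (Cst 3)) m1 [::].
  rewrite /= m10 m1n; exact.
apply: (@exec_seq _ _ _ _ 3 (update m2 2 0)); first exact: exec_store.
have m30 : update m2 2 0 0 = n by [].
have := exec_store square_addr (Cst 0) (update m2 2 0) [::].
move: m30; set m3 := update m2 2 0 => m30; rewrite /= m30.
have -> // : update m3 (n + 3) 0 =
  vmem K n (fun a => m0 a.+2) (fun=> 0) (update (fun=> 0) 0 (m0 1)).
apply: functional_extensionality => a; rewrite /m3 /vmem /m2 /m1 /sq_mem /update.
case: (a =P n + 3) => [->|an3].
  case: ltnP => h1.
    by rewrite !ifF ?[LHS]esym //; try lia; rewrite -m0_n3; congr m0; lia.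
  by case: ltnP => // h2; rewrite ifF //; case: (n) h1 h2 => [|[|p]]; lia.
case: (a =P 2) => [->|a2].
  by rewrite ifT; last lia.
case: (a =P 1) => [->|a1].
  by rewrite ifT; last lia.
case: (a =P _) => [->|aB].
  by rewrite ifF; [rewrite ifF; [rewrite ifT //|]|]; lia.
case: ltnP => h1.
  case: eqP => [->|a0] //; congr m0; lia.
case: ltnP => h2; first by rewrite m0_out //; lia.
by rewrite ifF ?m0_out //; lia.
Qed.

End Setup.

(** * The encoded instance as initial memory *)

Section Encoding.

Variable x : instance.
Local Notation n := (nv (igraph x)).

Definition adj_mem (x : instance) : memory := fun a => nth 0 (encode x) a.+2.

Lemma size_encode : size (encode x) = n * n + 2.
Proof. by rewrite /= size_allpairs size_enum_ord addn2. Qed.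

Lemma adj_mem_out a : n * n <= a -> adj_mem x a = 0.
Proof. by move=> h; rewrite /adj_mem nth_default // size_encode; lia. Qed.

Lemma nth_allpairs (S T : Type) (R : eqType) (f : S -> T -> R) (s : seq S) (t : seq T)
    x0 y0 z0 p q : p < size s -> q < size t ->
  nth z0 [seq f a b | a <- s, b <- t] (p * size t + q) = f (nth x0 s p) (nth y0 t q).
Proof.
move=> hp hq; elim: s p hp => [|a s IHs] [|p] //= hp.
  by rewrite nth_cat size_map hq (nth_map y0).
by rewrite nth_cat size_map ifF ?mulSn -?addnA ?addKn ?IHs //; lia.
Qed.

Lemma adj_memE (u v : 'I_n) : adj_mem x (u * n + v) = adj u v.
Proof.
rewrite /adj_mem /=; have := @nth_allpairs _ _ _ (fun u v : 'I_n => adj u v : nat)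
  (enum 'I_n) (enum 'I_n) u v 0 u v.
by rewrite size_enum_ord !nth_ord_enum; apply.
Qed.

End Encoding.

(** One counter more than the nesting depth, so that there is at least one, as [setupP] requires. *)
Definition loop_prog (c : cmd) : prog :=
  Seq (setup (depth c).+1) (compile (depth c).+1 0 c).

Definition initial_state (x : instance) : memory * seq nat :=
  (update (fun=> 0) 0 (iparam x), [::]).

Lemma loop_progP c x y :
    (den (nv (igraph x)) (adj_mem x) c (initial_state x)).2 = encode y ->
  exists2 t, t <= nv (igraph x) * 25 + 34 + tcost (depth c).+1 c (nv (igraph x)) &
    computes (loop_prog c) x t y.
Proof.
set n := nv _ => hy.
have m2 : nth 0 (encode x) 2 = 0.
  have [n0|n_gt0] := posnP n; first by rewrite nth_default // size_encode -/n n0.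
  by have := adj_memE (Ordinal n_gt0) (Ordinal n_gt0); rewrite adj_irr mul0n.
have m3 : nth 0 (encode x) (n + 3) = 0.
  have [n1|n_gt1] := leqP n 1; first by rewrite nth_default // size_encode -/n; nia.
  have := adj_memE (Ordinal n_gt1) (Ordinal n_gt1).
  by rewrite adj_irr mul1n addn1 addn3.
have m_out a : n * n + 2 <= a -> nth 0 (encode x) a = 0.
  by move=> ha; rewrite nth_default // size_encode.
have [//|t1 h1 e1] := @setupP n (nth 0 (encode x)) erefl m_out m2 m3 (depth c).+1.
have [|t2 h2 e2] := @compileP (depth c).+1 n (adj_mem x) (@adj_mem_out x) c 0
  (fun=> 0) (initial_state x).1 [::] (leqnSn _); first by [].
exists (t1 + t2); first exact: leq_add.
eexists; apply: (exec_seq e1).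
by rewrite -hy; exact: e2.
Qed.

(** * Deleting common neighbours *)

Lemma leq_card_bigcup (I T : finType) (P : pred I) (F : I -> {set T}) :
  #|\bigcup_(i | P i) F i| <= \sum_(i | P i) #|F i|.
Proof.
elim/big_rec2: _ => [|i m B _ IH]; first by rewrite cards0.
by apply: leq_trans (leq_card_setU _ _) _; rewrite leq_add2l.
Qed.

Section Domination.

Variable G : sgraph.
Local Notation vertex := 'I_(nv G).
Implicit Types (A S U : {set vertex}) (k r t : nat).

Definition common_nbrs A U : {set vertex} := [set w in A | [forall u in U, adj w u]].

(** The problem on the subgraph induced by [A], phrased inside [G] so that successive deletions keep
    one vertex type. *)
Definition yes_in k A : Prop :=
  exists S, [/\ S \subset A,
    forall v, v \in A -> v \notin S -> exists2 u, u \in S & adj v u,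
    independent S & #|S| <= k].

Definition few_common A r t : Prop :=
  forall U, U \subset A -> #|U| = r -> #|common_nbrs A U| <= t.

Lemma common_nbrsS A A' U : A' \subset A -> common_nbrs A' U \subset common_nbrs A U.
Proof.
move=> sA; apply/subsetP => w; rewrite !inE => /andP[wA ->].
by rewrite (subsetP sA).
Qed.

Lemma few_commonS A A' r t : A' \subset A -> few_common A r t -> few_common A' r t.
Proof.
move=> sA h U sU cU.
exact: leq_trans (subset_leq_card (common_nbrsS U sA)) (h _ (subset_trans sU sA) cU).
Qed.

(* A vertex [u] outside [U] dominates at most [t] common neighbours of [U] other
   than itself, since these are common neighbours of [u |: U]. *)
Lemma solution_meets k A S U r t :
    few_common A r.+1 t -> U \subset A -> #|U| = r ->
    k * t.+1 < #|common_nbrs A U| ->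
    S \subset A -> #|S| <= k ->
    (forall v, v \in A -> v \notin S -> exists2 u, u \in S & adj v u) ->
  exists2 u, u \in S & u \in U.
Proof.
move=> few sU cU big sS cS dom.
have [SU0|[u /setIP[uS uU]]] := set_0Vmem (S :&: U); last by exists u.
suff : #|common_nbrs A U| <= k * t.+1 by rewrite leqNgt big.
have cover : common_nbrs A U \subset
    \bigcup_(u in S) (u |: common_nbrs A (u |: U)).
  apply/subsetP => w wC; have := wC; rewrite inE => /andP[wA /forall_inP wU].
  have [wS|wS] := boolP (w \in S).
    by apply/bigcupP; exists w => //; rewrite !inE eqxx.
  have [u uS wu] := dom w wA wS; apply/bigcupP; exists u => //.
  rewrite !inE wA /=; apply/orP; right; apply/forall_inP => v.
  by rewrite !inE => /orP[/eqP->|/wU].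
apply: leq_trans (subset_leq_card cover) _.
apply: leq_trans (_ : \sum_(u in S) t.+1 <= _); last first.
  by rewrite sum_nat_const leq_mul2r cS orbT.
apply: leq_trans (leq_card_bigcup _ _) (leq_sum _ _) => u uS.
have uU : u \notin U.
  by apply/negP => uU; have := in_set0 u; rewrite -SU0 inE uS uU.
have := few (u |: U); rewrite cardsU1 uU cU add1n => /(_ _ erefl) few_u.
have uUA : u |: U \subset A by rewrite subUset sub1set (subsetP sS).
by apply: leq_trans (leq_card_setU _ _) _; rewrite cards1 add1n ltnS few_u.
Qed.

(** In both directions the solution meets [U], in a neighbour of [w]. Hence a solution in [A] avoids
    [w] by independence, and a solution in [A :\ w] dominates [w]. The summand 1 in the bound leaves
    enough common neighbours once [w] is gone. *)
Lemma yes_in_setD1 k A U w r t :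
    few_common A r.+1 t -> U \subset A -> #|U| = r -> w \in common_nbrs A U ->
    k * t.+1 + 1 < #|common_nbrs A U| ->
  yes_in k A <-> yes_in k (A :\ w).
Proof.
move=> few sU cU wC big.
have [wA wU] : w \in A /\ {in U, forall u, adj w u}.
  by move: wC; rewrite inE => /andP[-> /forall_inP].
split=> [[S [sS dom indep cS]]|[S [sS dom indep cS]]].
  have [u uS uU] := solution_meets few sU cU (leq_ltn_trans (leq_addr 1 _) big) sS cS dom.
  have wS : w \notin S by apply: contraL (wU u uU) => wS; exact: indep.
  exists S; split=> //; first by rewrite subsetD1 sS.
  by move=> v /setD1P[_ vA]; exact: dom.
have sAw : A :\ w \subset A by rewrite subD1set.
have sUw : U \subset A :\ w.
  by rewrite subsetD1 sU; apply/negP => /wU; rewrite adj_irr.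
have bigw : k * t.+1 < #|common_nbrs (A :\ w) U|.
  have -> : common_nbrs (A :\ w) U = common_nbrs A U :\ w.
    by apply/setP => v; rewrite !inE andbA.
  by have := cardsD1 w (common_nbrs A U); rewrite wC; lia.
have [u uS uU] := solution_meets (few_commonS sAw few) sUw cU bigw sS cS dom.
exists S; split=> //; first exact: subset_trans sAw.
move=> v vA vS; have [->|vw] := eqVneq v w; first by exists u => //; exact: wU.
by apply: dom => //; rewrite !inE vw.
Qed.

(** A set of [i] vertices and [j] common neighbours of it form the forbidden subgraph; irreflexivity
    makes the two sides disjoint. *)
Lemma few_common_bip_free i j :
  ~ has_subgraph (complete_bipartite i j) G -> few_common [set: vertex] i j.-1.
Proof.
move=> free U _ cU; rewrite leqNgt; apply/negP => big; apply: free.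
set C := common_nbrs _ U in big; have cC : j <= #|C| by lia.
have adjUC u w : u \in U -> w \in C -> adj u w.
  by move=> uU; rewrite inE adj_sym => /andP[_ /forall_inP]; exact.
pose f (z : 'I_(i + j)) : vertex := match split z with
  | inl a => enum_val (cast_ord (esym cU) a)
  | inr b => enum_val (widen_ord cC b) end.
exists f.
  move=> z1 z2; rewrite /f -{2}[z1]splitK -{2}[z2]splitK.
  case: (split z1) => a; case: (split z2) => b /= e.
  - by congr (unsplit (inl _)); move: e => /enum_val_inj/cast_ord_inj.
  - have := adjUC _ _ (enum_valP (cast_ord (esym cU) a)) (enum_valP (widen_ord cC b)).
    by rewrite e adj_irr.
  - have := adjUC _ _ (enum_valP (cast_ord (esym cU) b)) (enum_valP (widen_ord cC a)).
    by rewrite e adj_irr.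
  - congr (unsplit (inr _)); move: e => /enum_val_inj/(congr1 val) /= e.
    exact: val_inj.
move=> z1 z2; rewrite -[z1]splitK -[z2]splitK /= /bip_rel /f !unsplitK.
by case: (split z1) => a; case: (split z2) => b /=;
  rewrite ?ltn_ord ?[_ + _ < _]ltnNge ?leq_addr //= => _;
  [|rewrite adj_sym]; apply: adjUC; exact: enum_valP.
Qed.

End Domination.

(** * Induced subgraphs *)

Section InducedSubgraph.

Variables (G : sgraph) (A : {set 'I_(nv G)}).

Definition induced_rel : rel 'I_#|A| := fun u v => adj (enum_val u) (enum_val v).

Lemma induced_sym : symmetric induced_rel.
Proof. by move=> u v; rewrite /induced_rel adj_sym. Qed.

Lemma induced_irr : irreflexive induced_rel.
Proof. by move=> u; rewrite /induced_rel adj_irr. Qed.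

Definition induced : sgraph := SGraph induced_sym induced_irr.

Lemma has_subgraph_induced H : has_subgraph H induced -> has_subgraph H G.
Proof.
move=> [f f_inj f_adj]; exists (fun u => enum_val (f u)); last exact: f_adj.
by move=> u v /enum_val_inj/f_inj.
Qed.

Lemma ids_yes_induced k : ids_yes (Instance induced k) <-> yes_in k A.
Proof.
split=> [[S [dom indep cS]]|[S [sS dom indep cS]]].
  exists (enum_val @: S); split.
  - by apply/subsetP => _ /imsetP[u _ ->]; exact: enum_valP.
  - move=> v vA vS; rewrite -[v](enum_rankK_in vA vA) in vS *.
    have [|u uS vu] := dom (enum_rank_in vA v).
      by apply: contra vS; exact: imset_f.
    by exists (enum_val u) => //; exact: imset_f.
  - by move=> _ _ /imsetP[u uS ->] /imsetP[v vS ->]; exact: indep.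
  - by rewrite card_imset //; exact: enum_val_inj.
exists (enum_val @^-1: S); split.
- move=> v; rewrite inE => vS; have [u uS vu] := dom _ (enum_valP v) vS.
  have uA := subsetP sS u uS; exists (enum_rank_in uA u).
    by rewrite inE enum_rankK_in.
  by rewrite /= /induced_rel enum_rankK_in.
- by move=> u v; rewrite !inE; exact: indep.
- apply: leq_trans cS; rewrite -(card_imset _ enum_val_inj).
  by apply: subset_leq_card; apply/subsetP => _ /imsetP[u uS ->]; rewrite inE in uS.
Qed.

(** [enum_val] follows the order of [enum A], so the output matrix is a submatrix of the input and
    no renumbering has to be computed. *)
Lemma encode_induced k : encode (Instance induced k) =
  #|A| :: k :: [seq (adj u v : nat) | u <- enum A, v <- enum A].
Proof.
have -> : enum A = [seq enum_val u | u <- enum 'I_#|A|].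
  (* A vertex of [A] serves as default value for [nth]; without one, both lists are empty. *)
  case: (pickP [in A]) => [x0 _|A0]; last first.
    have cA : #|A| = 0 by rewrite (eq_card0 A0).
    rewrite (size0nil (etrans (esym (cardE A)) cA)).
    by rewrite (size0nil (etrans (size_enum_ord #|A|) cA)).
  apply: (@eq_from_nth _ x0); first by rewrite size_map size_enum_ord -cardE.
  move=> a; rewrite -cardE => ha; rewrite (nth_map (Ordinal ha)) ?size_enum_ord //.
  by rewrite (nth_ord_enum _ (Ordinal ha)) (enum_val_nth x0).
by rewrite allpairs_mapl allpairs_mapr.
Qed.

End InducedSubgraph.

(** * The kernelization algorithm *)

(** The loop rule for [CRep]: the invariant is indexed by the number of completed iterations. *)
Lemma iter_inv (S : Type) (P : nat -> S -> Prop) f n s :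
  P 0 s -> (forall a s, a < n -> P a s -> P a.+1 (f s)) -> P n (iter n f s).
Proof.
move=> P0 step; have : n <= n by [].
by elim: {-2}n => [//|m IHm] hm; rewrite iterS; apply: step (IHm (ltnW hm)).
Qed.

(** Layout of the working memory: seven registers, [i] cells for the current tuple, then one
    deletion flag per vertex. The parameter is in cell 0, where [setup] puts it. As multiplication
    is lacking, [row_reg] tracks [n] times [vtx_reg] whenever matrix rows are read. *)
Local Notation par_reg := 0.
Local Notation bound_reg := 1.
Local Notation acc_reg := 2.
Local Notation idx_reg := 3.
Local Notation count_reg := 4.
Local Notation vtx_reg := 5.
Local Notation row_reg := 6.
Local Notation tuple_reg m := (7 + m).

Definition reg a := VGet (VCst a).
Definition set_reg a e := CSet (VCst a) e.
Definition incr a e := set_reg a (VAdd (reg a) e).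
Definition block := foldr CSeq CSkip.

Section Algorithm.

Variable i : nat.

(** Flags mark deleted vertices, so the initial zeros stand for the full vertex set. *)
Definition dead_addr e := VAdd (VCst (7 + i)) e.
Definition dead e := VGet (dead_addr e).

(* Only the binary length of [k] counts in the input size, hence the cap at [n], which
   makes [n] iterations enough to multiply by it. *)
Definition small_par := VSub VOrder (VSub VOrder (reg par_reg)).

(** Multiplication by repeated addition: from [k' + 1], the first [k'] of the [n] iterations each
    add the old bound [t], which gives [k' * (t + 1) + 1]. *)
Definition next_bound := block
  [:: set_reg acc_reg (VAdd small_par (VCst 1));
      set_reg idx_reg (VCst 0);
      CRep (CIf (VSub small_par (reg idx_reg))
        (block [:: incr acc_reg (reg bound_reg); incr idx_reg (VCst 1)]) CSkip);
      set_reg bound_reg (reg acc_reg)].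

(** With truncated subtraction [(a - b) + (b - a)] is the distance of [a] and [b], so a summand is 1
    if the two entries agree and 0 otherwise. *)
Fixpoint clash (r m : nat) : vexpr :=
  if m is m'.+1 then
    let a := reg (tuple_reg m') in let b := reg (tuple_reg r) in
    VAdd (clash r m') (VSub (VCst 1) (VAdd (VSub a b) (VSub b a)))
  else VCst 0.

(* The value is 0 iff the current vertex is alive and adjacent to the first [r]
   vertices of the tuple, which are alive and pairwise distinct. *)
Fixpoint obstruction (r : nat) : vexpr :=
  if r is r'.+1 then
    let u := reg (tuple_reg r') in
    VAdd (obstruction r')
      (VAdd (dead u)
        (VAdd (VSub (VCst 1) (VMat (VAdd (reg row_reg) u))) (clash r' r')))
  else dead (reg vtx_reg).

Definition scan_step r := block
  [:: CIf (obstruction r) CSkip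
        (CIf (VSub (reg bound_reg) (reg count_reg)) (incr count_reg (VCst 1))
          (CSet (dead_addr (reg vtx_reg)) (VCst 1)));
      incr vtx_reg (VCst 1);
      incr row_reg VOrder].

Definition scan r := block
  [:: set_reg count_reg (VCst 0); set_reg vtx_reg (VCst 0);
      set_reg row_reg (VCst 0); CRep (scan_step r)].

(** Sets are enumerated as ordered tuples by [m] nested loops. Visiting a set in several orders is
    harmless, since every single deletion is safe. *)
Fixpoint scan_tuples (m l : nat) : cmd :=
  if m is m'.+1 then block
    [:: set_reg (tuple_reg l) (VCst 0);
        CRep (block [:: scan_tuples m' l.+1; incr (tuple_reg l) (VCst 1)])]
  else scan l.

Fixpoint levels (r : nat) : cmd :=
  if r is r'.+1 then block [:: next_bound; scan_tuples r' 0; levels r'] else CSkip.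

Definition count_step := block
  [:: CIf (dead (reg vtx_reg)) CSkip (incr count_reg (VCst 1));
      incr vtx_reg (VCst 1)].

Definition emit_step := block
  [:: CIf (dead (reg idx_reg)) CSkip (CEmit (VMat (VAdd (reg row_reg) (reg idx_reg))));
      incr idx_reg (VCst 1)].

Definition row_step := block
  [:: CIf (dead (reg vtx_reg)) CSkip
        (block [:: set_reg idx_reg (VCst 0); CRep emit_step]);
      incr vtx_reg (VCst 1);
      incr row_reg VOrder].

Definition output := block
  [:: set_reg count_reg (VCst 0); set_reg vtx_reg (VCst 0); CRep count_step;
      CEmit (reg count_reg); CEmit (reg par_reg);
      set_reg vtx_reg (VCst 0); set_reg row_reg (VCst 0); CRep row_step].

Definition kernelize (j : nat) := block
  [:: set_reg bound_reg (VCst j.-1); levels i; output].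

(** * Correctness of the kernelization *)

Section Correctness.

Variable x : instance.
Local Notation G := (igraph x).
Local Notation n := (nv G).
Local Notation M := (adj_mem x).

Definition alive (V : memory) : {set 'I_n} := [set v : 'I_n | V (7 + i + v) == 0].

Definition tuple_is (V : memory) (us : seq 'I_n) :=
  mkseq (fun m => V (tuple_reg m)) (size us) = [seq val u | u <- us].

Lemma tuple_is_rcons V us u :
  tuple_is V (rcons us u) <-> tuple_is V us /\ V (tuple_reg (size us)) = u.
Proof.
rewrite /tuple_is size_rcons mkseqS map_rcons; split.
  by move/rcons_inj => [].
by move=> [-> ->].
Qed.

Lemma clashP V r m : (veval n M V (clash r m) == 0) =
  (V (tuple_reg r) \notin mkseq (fun m => V (tuple_reg m)) m).
Proof.
elim: m => [|m IHm] //; rewrite mkseqS mem_rcons inE negb_or andbC -IHm /=.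
by rewrite addn_eq0; congr andb; lia.
Qed.

Lemma obstructionP (V : memory) us (a : 'I_n) : V vtx_reg = a -> V row_reg = a * n ->
    tuple_is V us ->
  (veval n M V (obstruction (size us)) == 0) =
  [&& a \in alive V, uniq us, all [in alive V] us & all (adj a) us].
Proof.
move=> Vw Vrow; elim/last_ind: us => [|us u IHus].
  by move=> _; rewrite /= Vw !andbT inE.
case/tuple_is_rcons => Vus Vu; rewrite size_rcons /= !addn_eq0 IHus // clashP.
rewrite Vu Vus (mem_map val_inj) Vrow adj_memE !all_rcons rcons_uniq.
have -> : (1 - adj a u == 0) = adj a u by case: (adj a u).
rewrite !inE; case: (uniq us); case: (all _ us); case: (all _ us);
  case: (u \in us); case: (adj a u); case: (V (7 + i + a) == 0);
  by case: (V (7 + i + u) == 0).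
Qed.

Definition frame (l : nat) (V V' : memory) :=
  [/\ V' par_reg = V par_reg, V' bound_reg = V bound_reg,
      forall m, m < l -> V' (tuple_reg m) = V (tuple_reg m) &
      alive V' \subset alive V].

Lemma frame_trans l V V' V'' : frame l V V' -> frame l V' V'' -> frame l V V''.
Proof.
move=> [p1 b1 t1 a1] [p2 b2 t2 a2]; split; rewrite ?p2 ?b2 //.
  by move=> m hm; rewrite t2 ?t1.
exact: subset_trans a2 a1.
Qed.

Lemma frameW l l' V V' : l' <= l -> frame l V V' -> frame l' V V'.
Proof. by move=> ll [p b t a]; split=> // m /leq_trans-/(_ _ ll)/t. Qed.

Lemma frame_tuple_is l V V' us : size us <= l -> frame l V V' ->
  tuple_is V us -> tuple_is V' us.
Proof.
rewrite /tuple_is => hl [_ _ t _] <-; apply/eq_in_map => m; rewrite mem_iota => /= hm.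
by apply: t; lia.
Qed.

(** The premises mirror the tests of [obstruction]: for other tuples a scan does nothing. The
    property survives later deletions. *)
Definition pruned (t : nat) (us : seq 'I_n) (A : {set 'I_n}) : Prop :=
  uniq us -> {subset us <= A} -> #|common_nbrs A [set u in us]| <= t.

Lemma prunedS t us (A A' : {set 'I_n}) : A' \subset A -> pruned t us A -> pruned t us A'.
Proof.
move=> sA h us_uniq sus; apply: leq_trans (subset_leq_card (common_nbrsS _ sA)) _.
by apply: h => // u /sus; apply: (subsetP sA).
Qed.

Lemma alive_eq V V' : (forall v, v < n -> V' (7 + i + v) = V (7 + i + v)) ->
  alive V' = alive V.
Proof. by move=> h; apply/setP => v; rewrite !inE h. Qed.

Definition kmin := minn (iparam x) n.

Lemma small_parE V : V par_reg = iparam x -> veval n M V small_par = kmin.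
Proof. by move=> /= ->; rewrite /kmin; lia. Qed.

(** The recurrence that yields [t_r] from [t_(r+1)]. *)
Definition level_bound t := kmin * t.+1 + 1.

(** * The scan for one fixed tuple *)

Section Scan.

Variables (us : seq 'I_n) (t : nat) (V0 : memory).
Let r := size us.
Let U := [set u in us].
Hypotheses (r_le : r <= i) (V0_us : tuple_is V0 us) (V0_few : few_common (alive V0) r.+1 t).
Hypothesis V0_bound : V0 bound_reg = level_bound t.

Let seen a A := [set v in common_nbrs A U | v < a].

Let inv a (s : memory * seq nat) (o : seq nat) := let V := s.1 in
  [/\ s.2 = o, V vtx_reg = a, V row_reg = a * n & frame i V0 V] /\
  [/\ yes_in kmin (alive V0) <-> yes_in kmin (alive V) &
      uniq us -> {subset us <= alive V} ->
      V count_reg = #|seen a (alive V)| /\ V count_reg <= level_bound t].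

Lemma scan_stepE V o : den n M (scan_step r) (V, o) =
  let V1 := if veval n M V (obstruction r) != 0 then V
    else if V bound_reg - V count_reg != 0 then update V count_reg (V count_reg + 1)
    else update V (7 + i + V vtx_reg) 1 in
  (update (update V1 vtx_reg (V1 vtx_reg + 1)) row_reg (V1 row_reg + n), o).
Proof. by rewrite /=; case: ifP => // _; case: ifP. Qed.

Lemma seenS a A (a_lt : a < n) : seen a.+1 A =
  if Ordinal a_lt \in common_nbrs A U then Ordinal a_lt |: seen a A else seen a A.
Proof.
have eq_a (v : 'I_n) : (v == Ordinal a_lt) = (v == a :> nat) by [].
case: ifPn => aC; apply/setP => v; rewrite !inE ltnS leq_eqVlt -?eq_a;
  case: eqP => //= ->; last by rewrite ltnn andbF andbT; move: aC; rewrite inE => /negPf.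
by move: aC; rewrite inE andbT.
Qed.

Lemma scan_stepP a s o : a < n -> inv a s o -> inv a.+1 (den n M (scan_step r) s) o.
Proof.
case: s => V o' a_lt [] [oE Vw Vrow fr] [yesV countV].
rewrite (oE : o' = o) {oE}; rewrite /= in Vw Vrow fr yesV countV.
pose w := Ordinal a_lt.
have V_us : tuple_is V us := frame_tuple_is r_le fr V0_us.
have := obstructionP (a := w) Vw Vrow V_us; rewrite scan_stepE -/r.
set V1 := if _ then _ else _ => obs.
(* The two closing increments leave flags and counter alone, so it is enough to treat the state [V1]
   before them. *)
suff : [/\ V1 vtx_reg = a, V1 row_reg = a * n, frame i V0 V1,
    yes_in kmin (alive V0) <-> yes_in kmin (alive V1) &
    uniq us -> {subset us <= alive V1} ->
      V1 count_reg = #|seen a.+1 (alive V1)| /\ V1 count_reg <= level_bound t].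
  move=> [h1 h2 [p b m ss] h4 h5].
  rewrite /inv /=; set V2 := update (update _ _ _) _ _.
  have e : alive V2 = alive V1 by apply: alive_eq.
  rewrite e; split; split=> //.
  - have -> : V2 vtx_reg = V1 vtx_reg + 1 by [].
    by rewrite h1 addn1.
  - have -> : V2 row_reg = V1 row_reg + n by [].
    by rewrite h2 mulSnr.
rewrite {}/V1; case: ifPn => [ob|/negPn ob]; rewrite /w in obs.
  split=> // us_uniq us_alive; have [cE c_le] := countV us_uniq us_alive.
  rewrite seenS ifF //; apply: contraNF ob; rewrite obs inE us_uniq.
  move=> /andP[-> /forall_inP h] /=; apply/andP; split; first exact/allP.
  by apply/allP => u uu; apply: h; rewrite inE.
move: obs; rewrite ob => /esym/and4P[w_alive us_uniq /allP us_alive /allP w_adj].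
have [cE c_le] := countV us_uniq us_alive.
have wC : w \in common_nbrs (alive V) U.
  by rewrite inE w_alive; apply/forall_inP => u; rewrite inE; exact: w_adj.
have V_bound : V bound_reg = level_bound t by case: fr => _ ->.
have wS : w \notin seen a (alive V) by rewrite inE ltnn andbF.
rewrite V_bound; case: ifPn => [c_lt|/negPn c_ge].
  have e : alive (update V count_reg (V count_reg + 1)) = alive V by apply: alive_eq.
  rewrite e; split=> //.
  by move=> _ _; rewrite seenS wC cardsU1 wS /update /= -cE; lia.
rewrite Vw; set V1 := update _ _ _.
have e : alive V1 = alive V :\ w.
  apply/setP => v; rewrite !inE /V1 /update eqn_add2l -val_eqE /=.
  by case: (_ == a).
have few : few_common (alive V) r.+1 t.
  by case: fr => _ _ _ ss; apply: few_commonS V0_few.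
have cU : #|U| = r by rewrite cardsE; apply/card_uniqP.
have sU : U \subset alive V by apply/subsetP => u; rewrite inE => /us_alive.
(* The counter has reached the bound, and [w] is one more common neighbour, not yet counted. *)
have big : kmin * t.+1 + 1 < #|common_nbrs (alive V) U|.
  apply: (@leq_trans #|w |: seen a (alive V)|).
    by rewrite cardsU1 wS -cE; move: c_ge; rewrite /level_bound; lia.
  by apply: subset_leq_card; rewrite subUset sub1set wC; apply/subsetP => v;
    rewrite inE => /andP[].
split=> //.
- case: fr => p b m ss; split=> //.
    by move=> q hq; rewrite -m // /V1 /update ifF //; lia.
  by rewrite e (subset_trans _ ss) // subD1set.
- by rewrite e; exact: iff_trans yesV (yes_in_setD1 few sU cU wC big).
move=> _ _; have -> : V1 count_reg = V count_reg by [].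
split=> //; rewrite cE; congr #|pred_of_set _|; rewrite seenS e ifF.
  by apply/setP => v; rewrite !inE -val_eqE /=; case: ltngtP; rewrite ?andbF ?andbT.
by rewrite !inE eqxx.
Qed.

Lemma scanP o : let s := den n M (scan r) (V0, o) in
  [/\ s.2 = o, frame i V0 s.1,
      yes_in kmin (alive V0) <-> yes_in kmin (alive s.1) &
      pruned (level_bound t) us (alive s.1)].
Proof.
set V := update (update (update V0 count_reg 0) vtx_reg 0) row_reg 0.
have V_alive : alive V = alive V0 by apply: alive_eq.
have [] : inv n (iter n (den n M (scan_step r)) (V, o)) o.
  apply: (iter_inv (P := fun a s => inv a s o)); last first.
    by move=> a s; exact: scan_stepP.
  split; first by split=> //; split=> //; rewrite V_alive.
  rewrite /= V_alive; split=> // _ _.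
  by split=> //; apply/esym/eqP; rewrite cards_eq0; apply/eqP/setP => v; rewrite !inE andbF.
have -> : iter n (den n M (scan_step r)) (V, o) = den n M (scan r) (V0, o) by [].
move=> [oE _ _ fr] [yesE countE]; split=> // us_uniq us_alive.
have [cE c_le] := countE us_uniq us_alive.
apply: leq_trans c_le; rewrite cE; apply: subset_leq_card.
by apply/subsetP => v vC; rewrite inE vC ltn_ord.
Qed.

End Scan.

(** * All tuples of one length, then all lengths *)

Section Levels.

Variable t : nat.

Definition scan_pre r V :=
  [/\ V par_reg = iparam x, V bound_reg = level_bound t & few_common (alive V) r.+1 t].

Lemma scan_pre_frame r V V' : frame 0 V V' -> scan_pre r V -> scan_pre r V'.
Proof.
move=> [p b _ sA] [p' b' few]; split; rewrite ?p ?b //.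
exact: few_commonS sA few.
Qed.

(** The loop over entry [l] maintains that all tuples with a smaller entry there are pruned; by
    [prunedS] the deletions made for later entries do not spoil this. *)
Lemma scan_tuplesP m us V o : size us + m <= i -> tuple_is V us ->
    scan_pre (size us + m) V ->
  let s := den n M (scan_tuples m (size us)) (V, o) in
  [/\ s.2 = o, frame (size us) V s.1,
      yes_in kmin (alive V) <-> yes_in kmin (alive s.1) &
      forall vs, size vs = m -> pruned (level_bound t) (us ++ vs) (alive s.1)].
Proof.
elim: m us V o => [|m IHm] us V o us_le V_us pre.
  rewrite addn0 in us_le pre; case: pre => p b few.
  have [oE fr yesE pr] := scanP us_le V_us few b o.
  split=> //; first exact: frameW fr.
  by move=> vs /size0nil ->; rewrite cats0.
set l := size us; set V1 := update V (tuple_reg l) 0.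
pose inv a (s : memory * seq nat) := [/\ s.2 = o, s.1 (tuple_reg l) = a, frame l V s.1,
  yes_in kmin (alive V) <-> yes_in kmin (alive s.1) &
  forall (u : 'I_n) vs, u < a -> size vs = m ->
    pruned (level_bound t) (us ++ u :: vs) (alive s.1)].
have alive_upd V' c : alive (update V' (tuple_reg l) c) = alive V'.
  by apply: alive_eq => v hv; rewrite /update ifF //; lia.
have frame_upd V' c : frame l V' (update V' (tuple_reg l) c).
  split; rewrite // ?alive_upd // => q hq; rewrite /update ifF //; lia.
have : inv n (iter n (den n M (block [:: scan_tuples m l.+1; incr (tuple_reg l) (VCst 1)]))
   (V1, o)).
  apply: iter_inv; first by rewrite /V1; split; rewrite /= ?alive_upd // /update eqxx.
  move=> a [V' o'] a_lt [/= -> V'l fr yesE prE].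
  pose w := Ordinal a_lt.
  have V'_us : tuple_is V' (rcons us w).
    by apply/tuple_is_rcons; split=> //; exact: frame_tuple_is fr V_us.
  have pre' : scan_pre (size (rcons us w) + m) V'.
    by rewrite size_rcons addSnnS; apply: scan_pre_frame pre; exact: frameW fr.
  have [|] := IHm (rcons us w) V' o _ V'_us pre'; first by rewrite size_rcons addSnnS.
  rewrite size_rcons -/l; case: (den _ _ _ _) => V2 o2 /= -> fr2 yes2 pr2.
  split=> //=.
  - by rewrite /update eqxx; case: fr2 => _ _ -> //; rewrite V'l addn1.
  - apply: frame_trans (frame_upd _ _); apply: frame_trans fr _.
    exact: frameW fr2.
  - by rewrite alive_upd; exact: iff_trans yesE yes2.
  move=> u vs; rewrite alive_upd ltnS leq_eqVlt => /orP[/eqP ua|ua] sz.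
    have -> : u = w by apply: val_inj.
    by rewrite -cat_rcons; exact: pr2.
  by apply: prunedS (prE u vs ua sz); case: fr2.
have -> : iter n (den n M (block [:: scan_tuples m l.+1; incr (tuple_reg l) (VCst 1)]))
   (V1, o) = den n M (scan_tuples m.+1 l) (V, o) by [].
case=> oE _ fr yesE prE; split=> // [] [//|u vs] [sz].
by apply: prE.
Qed.

Lemma next_boundP V o : V par_reg = iparam x -> V bound_reg = t ->
  exists V', den n M next_bound (V, o) = (V', o) /\
    [/\ V' par_reg = iparam x, V' bound_reg = level_bound t & alive V' = alive V].
Proof.
move=> Vp Vb.
pose inv a (s : memory * seq nat) := [/\ s.2 = o, s.1 par_reg = iparam x,
  s.1 bound_reg = t & alive s.1 = alive V] /\
  [/\ s.1 idx_reg = minn a kmin & s.1 acc_reg = kmin + 1 + s.1 idx_reg * t].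
set V1 := update (update V acc_reg (kmin + 1)) idx_reg 0.
set body := CIf (VSub small_par (reg idx_reg))
        (block [:: incr acc_reg (reg bound_reg); incr idx_reg (VCst 1)]) CSkip.
have : inv n (iter n (den n M body) (V1, o)).
  apply: iter_inv.
    by split; split; rewrite //= ?min0n // /V1 /update /= mul0n addn0.
  move=> a [V' o'] a_lt [] [oE p b al] [idx acc]; rewrite /= in oE p b al idx acc.
  have -> : den n M body (V', o') = if kmin - V' idx_reg != 0 then
      (update (update V' acc_reg (V' acc_reg + V' bound_reg)) idx_reg (V' idx_reg + 1), o')
    else (V', o') by rewrite -(small_parE p).
  case: ifPn => [lt_k|/negPn ge_k]; last first.
    by split; split=> //=; move: ge_k; rewrite idx; lia.
  split; split=> //=.
    by rewrite /update /=; lia.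
  by rewrite /update /= b acc; lia.
have -> : den n M next_bound (V, o) = let s := iter n (den n M body) (V1, o) in
    (update s.1 bound_reg (s.1 acc_reg), s.2) by rewrite /V1 -(small_parE Vp).
case: (iter _ _ _) => V' o' [[/= -> p b al] [idx acc]].
exists (update V' bound_reg (V' acc_reg)); split=> //; split=> //.
rewrite /update /= acc idx /level_bound (minn_idPr (geq_minr _ _)) mulnS.
by move: (kmin * t) => y; lia.
Qed.

End Levels.

(** Pruning all tuples of length [r] provides the bound on common neighbours that the next level,
    with sets of one vertex less, takes as hypothesis. *)
Lemma levelsP r V o : r <= i -> V par_reg = iparam x ->
    few_common (alive V) r (V bound_reg) ->
  let s := den n M (levels r) (V, o) in
  [/\ s.2 = o, s.1 par_reg = iparam x,
      yes_in kmin (alive V) <-> yes_in kmin (alive s.1) &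
      few_common (alive s.1) 0 (iter r level_bound (V bound_reg))].
Proof.
elim: r V o => [|r IHr] V o r_le Vp few; first by [].
have [V1 [E1 [p1 b1 al1]]] := next_boundP o Vp erefl.
have pre1 : scan_pre (V bound_reg) (size (Nil 'I_n) + r) V1 by split; rewrite ?al1.
have [o2 [p2 b2 _ sA] yes2 pr2] := scan_tuplesP (us := [::]) o (ltnW r_le) erefl pre1.
have -> : den n M (levels r.+1) (V, o) = den n M (levels r)
    (den n M (scan_tuples r 0) (den n M next_bound (V, o))) by [].
rewrite E1; move: o2 p2 b2 sA yes2 pr2.
case: (den n M _ _) => V2 o2 /= -> p2 b2 sA yes2 pr2.
rewrite al1 in sA yes2; rewrite b1 in b2.
have few2 : few_common (alive V2) r (V2 bound_reg).
  move=> U sU cU; rewrite b2.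
  (* The set [U] was scanned as the tuple [enum U]. *)
  have := pr2 (enum U); rewrite -cardE => /(_ cU (enum_uniq _)).
  have -> : [set u in enum U] = U by apply/setP => u; rewrite inE mem_enum.
  by apply=> u; rewrite mem_enum; exact: (subsetP sU).
have [] := IHr V2 o (ltnW r_le) (etrans p2 p1) few2.
rewrite b2 -iterSr => h1 h2 h3 h4; split=> //.
exact: iff_trans yes2 h3.
Qed.

(** * Writing the induced subgraph on the output tape *)

Definition alive_seq (V : memory) a := [seq v <- iota 0 a | V (7 + i + v) == 0].

Lemma alive_seqS V a : alive_seq V a.+1 =
  if V (7 + i + a) == 0 then rcons (alive_seq V a) a else alive_seq V a.
Proof.
have E : iota 0 a.+1 = rcons (iota 0 a) a by rewrite -cats1 -addn1 iotaD.
by rewrite /alive_seq E filter_rcons.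
Qed.

Lemma alive_seqE V : alive_seq V n = [seq val v | v <- enum (alive V)].
Proof.
rewrite /alive_seq -val_enum_ord filter_map enumT; congr map.
by apply: eq_filter => v; rewrite /= [RHS]inE.
Qed.

Definition same_alive (V V' : memory) := forall v, V' (7 + i + v) = V (7 + i + v).

Lemma same_alive_seq V V' a : same_alive V V' -> alive_seq V' a = alive_seq V a.
Proof. by move=> h; apply: eq_filter => v; rewrite h. Qed.

Lemma count_loopP V o :
  let s := den n M (CRep count_step) (update (update V count_reg 0) vtx_reg 0, o) in
  [/\ s.2 = o, s.1 par_reg = V par_reg, same_alive V s.1 &
      s.1 count_reg = #|alive V|].
Proof.
pose inv a (s : memory * seq nat) := [/\ s.2 = o, s.1 par_reg = V par_reg,
  s.1 vtx_reg = a, same_alive V s.1 & s.1 count_reg = size (alive_seq V a)].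
rewrite cardE -(size_map val) -alive_seqE => s.
suff : inv n s by case.
apply: iter_inv; first by split.
move=> a [V' o'] a_lt [] oE p w al c; rewrite /= in oE p w al c.
rewrite /inv alive_seqS /= w -(al a); case: ifPn => [h|/negPn h]; rewrite ?(negPf h) ?h.
  by split=> //; rewrite /update /= w addn1.
by split=> //; rewrite /update /= ?w ?size_rcons ?c addn1.
Qed.

Lemma emit_loopP V o :
  let s := den n M (CRep emit_step) (update V idx_reg 0, o) in
  [/\ s.2 = o ++ [seq M (V row_reg + v) | v <- alive_seq V n],
      s.1 vtx_reg = V vtx_reg, s.1 row_reg = V row_reg & same_alive V s.1].
Proof.
pose inv a (s : memory * seq nat) :=
  [/\ s.2 = o ++ [seq M (V row_reg + v) | v <- alive_seq V a],
      s.1 vtx_reg = V vtx_reg, s.1 row_reg = V row_reg, s.1 idx_reg = a &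
      same_alive V s.1].
move=> s; suff : inv n s by case.
apply: iter_inv; first by split=> //=; rewrite cats0.
move=> a [V' o'] a_lt [] oE w row idx al; rewrite /= in oE w row idx al.
rewrite /inv alive_seqS /= idx -(al a); case: ifPn => [h|/negPn h]; rewrite ?(negPf h) ?h.
  by split=> //; rewrite /update /= idx addn1.
split=> //; last by rewrite /update /= idx addn1.
by rewrite /= oE map_rcons rcons_cat row.
Qed.

Lemma row_loopP V o :
  let s := den n M (CRep row_step) (update (update V vtx_reg 0) row_reg 0, o) in
  s.2 = o ++ [seq M (u * n + v) | u <- alive_seq V n, v <- alive_seq V n].
Proof.
pose inv a (s : memory * seq nat) :=
  [/\ s.2 = o ++ [seq M (u * n + v) | u <- alive_seq V a, v <- alive_seq V n],
      s.1 vtx_reg = a, s.1 row_reg = a * n & same_alive V s.1].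
move=> s; suff : inv n s by case.
apply: iter_inv; first by split=> //=; rewrite cats0.
move=> a [V' o'] a_lt [] oE w row al; rewrite /= in oE w row al.
(* One iteration unfolded, with the inner loop kept intact for [emit_loopP]. *)
change (inv a.+1 (let s := if V' (7 + i + V' vtx_reg) != 0 then (V', o')
      else den n M (CRep emit_step) (update V' idx_reg 0, o') in
    (update (update s.1 vtx_reg (s.1 vtx_reg + 1)) row_reg (s.1 row_reg + n), s.2))).
rewrite /inv alive_seqS w -(al a); case: ifPn => [h|/negPn h]; rewrite ?(negPf h) ?h.
  split=> //; first by rewrite /update /= w addn1.
  by rewrite /update /= row mulSnr.
have [] := emit_loopP V' o'; case: (den _ _ _ _) => V2 o2 /= -> w2 row2 al2.
split.
- by rewrite allpairs_rcons catA oE row (same_alive_seq _ al).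
- by rewrite /update /= w2 w addn1.
- by rewrite /update /= row2 row mulSnr.
- by move=> v; rewrite -al -al2.
Qed.

Lemma outputP V :
  (den n M output (V, [::])).2 = encode (Instance (induced (alive V)) (V par_reg)).
Proof.
rewrite encode_induced.
have [] := count_loopP V [::].
have -> : den n M output (V, [::]) =
  let s := den n M (CRep count_step) (update (update V count_reg 0) vtx_reg 0, [::]) in
  den n M (CRep row_step) (update (update s.1 vtx_reg 0) row_reg 0,
    rcons (rcons s.2 (s.1 count_reg)) (s.1 par_reg)) by [].
case: (den n M (CRep count_step) _) => V1 o1 /= -> p1 al1 c1.
rewrite row_loopP (same_alive_seq _ al1) c1 p1 /= alive_seqE allpairs_mapl allpairs_mapr.
congr [:: _, _ & _].
by apply: eq_allpairs => u v; rewrite adj_memE.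
Qed.

Lemma kernelizeP j : ~ has_subgraph (complete_bipartite i j) G ->
  exists A : {set 'I_n},
  [/\ (den n M (kernelize j) (initial_state x)).2 = encode (Instance (induced A) (iparam x)),
      yes_in kmin [set: 'I_n] <-> yes_in kmin A &
      #|A| <= iter i level_bound j.-1].
Proof.
move=> free; set V := update (initial_state x).1 bound_reg j.-1.
have V_alive : alive V = [set: 'I_n] by apply/setP => v; rewrite !inE.
have few : few_common (alive V) i (V bound_reg).
  by rewrite V_alive; exact: few_common_bip_free.
have [] := levelsP [::] (leqnn i) (erefl : V par_reg = iparam x) few.
have -> : den n M (kernelize j) (initial_state x) =
  den n M output (den n M (levels i) (V, [::])) by [].
case: (den n M (levels i) _) => V1 o1 /= -> p1 yes1 few1.
exists (alive V1); split.
- by rewrite outputP p1.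
- by rewrite -V_alive.
(* Every living vertex is a common neighbour of the empty set, so level 0 bounds the order of the
   kernel. *)
have := few1 set0 (sub0set _) (cards0 _).
suff -> : common_nbrs (alive V1) set0 = alive V1 by [].
apply/setP => v; rewrite inE andb_idr // => _; apply/forall_inP => u.
by rewrite inE.
Qed.

End Correctness.
End Algorithm.

(** * Return to the original problem, and the bound on the order *)

Lemma yes_in_kmin x (A : {set 'I_(nv (igraph x))}) :
  yes_in (kmin x) A <-> yes_in (iparam x) A.
Proof.
split=> [[S [sS dom indep cS]]|[S [sS dom indep cS]]]; exists S; split=> //.
  by apply: leq_trans cS _; rewrite geq_minl.
by rewrite leq_min cS -[X in _ <= X](card_ord (nv (igraph x))) max_card.
Qed.

Lemma yes_in_setT x : yes_in (iparam x) [set: 'I_(nv (igraph x))] <-> ids_yes x.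
Proof.
split=> [[S [_ dom indep cS]]|[S [dom indep cS]]]; exists S; split=> //.
  by move=> v; apply: dom.
by move=> v _; apply: dom.
Qed.

Lemma level_bound_le i j k m : 0 < i -> i <= j -> 0 < k -> m <= k ->
  iter i (fun t => m * t.+1 + 1) j.-1 <= 3 * (j * k ^ i).
Proof.
move=> i_gt0 ij k_gt0 mk.
have [k1|k_gt1] := leqP k 1.
  have k_eq1 : k = 1 by lia.
  (* For [k = 1] each step adds at most 2, and [i <= j] then gives [3 * j]. *)
  have H r : iter r (fun t => m * t.+1 + 1) j.-1 <= j.-1 + r * 2.
    elim: r => [|r IHr]; first by rewrite addn0.
    rewrite iterS; apply: leq_trans (_ : (j.-1 + r * 2).+1 + 1 <= _); last by lia.
    by rewrite leq_add2r -[leqRHS]mul1n leq_mul // -k_eq1.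
  by apply: leq_trans (H i) _; rewrite k_eq1 exp1n; lia.
(* The shift by 3 absorbs the additive terms: [k * (t + 1) + 1 + 3 <= k * (t + 3)] as soon as
   [k >= 2]. *)
have H r : iter r (fun t => m * t.+1 + 1) j.-1 + 3 <= (j + 2) * k ^ r.
  elim: r => [|r IHr]; first by rewrite expn0 /=; lia.
  rewrite iterS expnS; move: (iter _ _ _) (k ^ r) IHr => t y h.
  have h1 : m * t.+1 <= k * t.+1 by rewrite leq_mul2r mk orbT.
  have h2 : k * (t + 3) <= k * ((j + 2) * y) by rewrite leq_mul2l h orbT.
  by rewrite mulnCA; lia.
have y_gt0 : 0 < k ^ i by rewrite expn_gt0 k_gt0.
have : (j + 2) * k ^ i <= 3 * j * k ^ i by rewrite leq_mul2r; lia.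
by have := H i; rewrite mulnA; lia.
Qed.

(** * Sizes *)

Lemma leq_trunc_log a : trunc_log 2 a <= a.
Proof.
case: a => [|a]; first by rewrite trunc_log0.
exact: leq_trans (ltnW (ltn_expl _ _)) (trunc_logP _ _).
Qed.

Lemma leq_order_isize x : nv (igraph x) <= isize x.
Proof.
apply: (@leq_trans (size (encode x))); first by rewrite size_encode; nia.
by rewrite -sum1_size /isize; apply: leq_sum.
Qed.

(** Matrix entries are 0 or 1 and take one digit each; any [a] has at most [a + 1] digits. *)
Lemma isize_le x : isize x <=
  (nv (igraph x)).+1 + (iparam x).+1 + nv (igraph x) * nv (igraph x).
Proof.
rewrite /isize /= !big_cons addnA leq_add //.
  by rewrite leq_add // ltnS leq_trunc_log.
rewrite (eq_big_seq (fun=> 1)); last first.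
  by move=> _ /allpairsP[[u v] [_ _ ->]] /=; case: (adj u v); rewrite ?trunc_log0 ?trunc_log1.
by rewrite sum1_size size_allpairs size_enum_ord.
Qed.

Theorem theorem3 :
  exists C : nat, forall i j : nat, 1 <= i -> i <= j ->
    has_poly_kernel (bip_free_instance i j) ids_yes
      (fun k => C * (j * k ^ i)).
Proof.
exists 3 => i j i_gt0 ij; set A := kernelize i j.
have [d time_le] : poly_bounded (fun n => n * 25 + 34 + tcost (depth A).+1 A n).
  apply: poly_bounded_add (poly_bounded_tcost _ _).
  apply: poly_bounded_add (poly_bounded_cst _).
  exact: poly_bounded_mul poly_bounded_id (poly_bounded_cst _).
pose h k := 3 * (j * k ^ i).
have h_poly : poly_bounded h.
  apply: poly_bounded_mul (poly_bounded_cst _) _.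
  exact: poly_bounded_mul (poly_bounded_cst _) (poly_bounded_exp _ poly_bounded_id).
(* The time bound in the order is monotone and the order is at most the input size. The size bound
   is [isize_le] with at most [h k] vertices; the parameter is unchanged, hence [id]. *)
exists (loop_prog A), (fun s => d * s ^ d + d),
  (fun k => h k + 1 + (k + 1) + h k * h k), id; split.
- by exists d.
- apply: poly_bounded_add (poly_bounded_mul h_poly h_poly).
  apply: poly_bounded_add; apply: poly_bounded_add (poly_bounded_cst 1) => //.
  exact: poly_bounded_id.
move=> x [k_gt0 free]; have [B [outE yesE B_le]] := kernelizeP free.
have [t t_le comp] := loop_progP outE.
have B_h : #|B| <= h (iparam x).
  by apply: leq_trans B_le (level_bound_le i_gt0 ij k_gt0 _); rewrite geq_minl.
exists (Instance (induced B) (iparam x)), t; split=> //.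
- split=> //; apply: leq_trans t_le (leq_trans (time_le _) _).
  rewrite leq_add2r leq_mul2l; case: (d) => [|e] //.
  by rewrite leq_exp2r ?leq_order_isize.
- by split=> // /has_subgraph_induced.
- apply: iff_trans (iff_sym (yes_in_setT x)) _.
  apply: iff_trans (iff_sym (yes_in_kmin _)) (iff_trans yesE _).
  exact: iff_trans (yes_in_kmin _) (iff_sym (ids_yes_induced _ _)).
- split=> //; apply: leq_trans (isize_le _) _.
  by rewrite /= !addn1 leq_add ?leq_mul // leq_add.
Qed.
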